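(* Let $k\ge 1$ and $r\ge 2$ be integers, let $T$ be a tree on $k+1$ vertices, and let $n$ be a positive integer. If $k>r$, then \[ \mathrm{ex}_r(n,\text{Berge-}T) \leq \frac{2(r-1)}{k}\binom{k}{r}n. \] If $k\le r$, then \[ \mathrm{ex}_r(n,\text{Berge-}T)\le (k-1)n. \]
   Context: All graphs and hypergraphs are finite and simple. A hypergraph $\mathcal{H}$ contains a Berge-$F$ (Berge copy of the graph $F$) if there are an injection $\varphi:V(F)\to V(\mathcal{H})$ and an injection $f:E(F)\to E(\mathcal{H})$ with $\{\varphi(u),\varphi(v)\}\subset f(uv)$ for every edge $uv\in E(F)$; otherwise it is Berge-$F$-free. $\mathrm{ex}_r(n,\text{Berge-}F)$ is the maximum number of hyperedges in an $n$-vertex $r$-uniform Berge-$F$-free hypergraph. *)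

(* Defs.v *)
From mathcomp Require Import all_boot all_order all_algebra.

Set Implicit Arguments.
Unset Strict Implicit.
Unset Printing Implicit Defensive.

Record sgraph := SGraph {
  svertex :> finType;
  sedge : rel svertex;
  sedge_sym : symmetric sedge;
  sedge_irrefl : irreflexive sedge
}.

Definition edges (G : sgraph) : {set {set G}} :=
  [set [set p.1; p.2] | p : G * G & sedge p.1 p.2].

Definition connected_graph (G : sgraph) : Prop :=
  0 < #|G| /\ forall x y : G, connect (@sedge G) x y.

(* The bound on the size excludes [::] and the back-and-forth walks
   [:: x; y], which satisfy [ucycle] without being graph cycles. *)
Definition acyclic_graph (G : sgraph) : Prop :=
  forall c : seq G, 2 < size c -> ~ ucycle (@sedge G) c.

Definition is_tree (G : sgraph) : Prop :=
  connected_graph G /\ acyclic_graph G.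

(* A simple hypergraph on the vertex set V is its set of hyperedges,
   H : {set {set V}}. *)
Definition uniform (V : finType) (r : nat) (H : {set {set V}}) : bool :=
  [forall h in H, #|h| == r].

(* The map on edges is a total finite function on {set F}; only its
   restriction to [edges F] is constrained. *)
Definition contains_berge (F : sgraph) (V : finType) (H : {set {set V}}) :
    bool :=
  [exists phi : {ffun F -> V}, exists f : {ffun {set F} -> {set V}},
    [&& injectiveb phi,
        dinjectiveb f (edges F),
        [forall e in edges F, f e \in H]
      & [forall u, forall v,
          sedge u v ==> ([set phi u; phi v] \subset f [set u; v])]]].

Definition berge_free (F : sgraph) (V : finType) (H : {set {set V}}) : bool :=
  ~~ contains_berge F H.

(* When F has no edge and at most n vertices, every hypergraph contains a
   Berge-F and the maximum over the empty family is 0. *)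
Definition ex_berge (r n : nat) (F : sgraph) : nat :=
  \max_(H : {set {set 'I_n}} | uniform r H && berge_free F H) #|H|.

(* Main.v *)
Require Import Defs.
From mathcomp Require Import all_boot all_order all_algebra.
From mathcomp Require Import zify lra.
Import Order.TTheory GRing.Theory Num.Theory.

(** Pick a subfamily [S] of the hyperedges maximizing [#|S|] minus the number
    of pairs covered by [S].  By Hall's theorem, maximality makes the covered
    ("blue") pairs matchable into [S], and the remaining hyperedges matchable
    to uncovered ("red") pairs.  The graph of blue and red pairs thus has
    distinct hyperedge representatives, so it contains no copy of [T], while
    the hyperedges number at most its blue [r]-cliques plus its red edges.  By
    greedy embedding, a [T]-free graph on a nonempty vertex set has a vertex of
    degree less than [k]; deleting it destroys at most [a] red edges and
    ['C(b, r - 1)] blue cliques with [a + b <= k - 1], which is at most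
    ['C(k - 1, r - 1)] if [r < k] and at most [k - 1] otherwise. *)

Set Implicit Arguments.
Unset Strict Implicit.


(** * Hall's marriage theorem *)

Section Hall.
Variables A B : finType.
Implicit Types (F : A -> {set B}) (S X : {set A}).

Definition nbrs F X : {set B} := \bigcup_(a in X) F a.

Lemma nbrsP F X b : reflect (exists2 a, a \in X & b \in F a) (b \in nbrs F X).
Proof. exact: bigcupP. Qed.

Lemma nbrsU F X Y : nbrs F (X :|: Y) = nbrs F X :|: nbrs F Y.
Proof. exact: bigcup_setU. Qed.

Lemma nbrsD F X N : nbrs (fun a => F a :\: N) X = nbrs F X :\: N.
Proof.
apply/setP=> b; apply/nbrsP/setDP => [[a aX /setDP[bF bN]]|[/nbrsP[a aX bF] bN]].
  by split=> //; apply/nbrsP; exists a.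
by exists a => //; apply/setDP.
Qed.

(** Induction on [#|S|]. A nonempty proper tight [X] is matched first and the rest of [S] is matched
    outside [nbrs F X]; if there is none, any [a] may take any neighbour [b]. The point [b0]
    supplies a total function when [S] is empty. *)
Lemma hall F S (b0 : B) :
  (forall X, X \subset S -> #|X| <= #|nbrs F X|) ->
  exists2 f : A -> B, {in S &, injective f} & {in S, forall a, f a \in F a}.
Proof.
have [n] := ubnP #|S|; elim: n F S => // n IH F S leSn hallF.
have [->|[a aS]] := set_0Vmem S.
  by exists (fun=> b0) => [x y|x]; rewrite inE.
have [/existsP[X /and3P[X0 XS tightX]]|] :=
  boolP [exists X : {set A}, [&& X != set0, X \proper S & #|nbrs F X| <= #|X|]].
  have [|X' X'X|f f_inj fF] := IH F X.
  - exact: leq_trans (proper_card XS) leSn.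
  - by apply: hallF; apply: subset_trans X'X (proper_sub XS).
  have [||g g_inj gF] := IH (fun b => F b :\: nbrs F X) (S :\: X).
  - have := cardsID X S; rewrite (setIidPr (proper_sub XS)).
    by move: X0; rewrite -card_gt0; lia.
  - move=> Y YSX; rewrite nbrsD.
    have dXY : [disjoint X & Y].
      by rewrite disjoint_sym; move: YSX; rewrite subsetD => /andP[].
    have := hallF (X :|: Y).
    rewrite subUset (proper_sub XS) (subset_trans YSX (subsetDl _ _)) => /(_ isT).
    rewrite nbrsU cardsU (disjoint_setI0 dXY) cards0 cardsU setIC cardsD.
    have := subset_leq_card (subsetIl (nbrs F Y) (nbrs F X)); lia.
  exists (fun x => if x \in X then f x else g x) => [x y xS yS|x xS].
    have hg z : z \in S -> z \notin X -> g z \notin nbrs F X.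
      by move=> zS zX; have := gF z; rewrite !inE zX zS => /(_ isT) /andP[].
    have hf z : z \in X -> f z \in nbrs F X.
      by move=> zX; apply/nbrsP; exists z => //; apply: fF.
    case: ifPn => xX; case: ifPn => yX.
    + exact: f_inj.
    + by move=> E; move: (hg _ yS yX); rewrite -E hf.
    + by move=> E; move: (hg _ xS xX); rewrite E hf.
    + by apply: g_inj; rewrite inE ?xX ?yX.
  case: ifPn => xX; first exact: fF.
  by have := gF x; rewrite !inE xX xS => /(_ isT) /andP[].
(* Every nonempty proper subset now has a surplus neighbour, which pays for the removal of [b]. *)
rewrite negb_exists => /forallP loose.
have : 0 < #|nbrs F [set a]|.
  by apply: leq_trans (hallF [set a] _); rewrite ?cards1 ?sub1set.
rewrite card_gt0 => /set0Pn[b /nbrsP[a' /set1P-> bFa]].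
have [||f f_inj fF] := IH (fun x => F x :\: [set b]) (S :\ a).
- by move: leSn; rewrite (cardsD1 a) aS.
- move=> X XSa; rewrite nbrsD.
  have [->|X0] := eqVneq X set0; first by rewrite cards0.
  have XpS : X \proper S.
    by apply: sub_proper_trans XSa _; rewrite properD1.
  have := loose X; rewrite X0 XpS /= -ltnNge.
  by rewrite (cardsD1 b (nbrs F X)); case: (b \in _) => //= /ltnW.
have nb x : x \in S -> x != a -> f x != b /\ f x \in F x.
  by move=> xS xa; have := fF x; rewrite !inE xa xS => /(_ isT) /andP[].
exists (fun x => if x == a then b else f x) => [x y xS yS|x xS].
  case: eqVneq => [->|xa]; case: eqVneq => [->|ya] //.
  + by move=> E; have [] := nb _ yS ya; rewrite -E eqxx.
  + by move=> E; have [] := nb _ xS xa; rewrite E eqxx.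
  + by apply: f_inj; rewrite !inE ?xa ?ya.
by case: eqVneq => [->//|xa]; have [] := nb _ xS xa.
Qed.

End Hall.

(** * Splitting the hyperedges by maximal deficiency *)

(** Hall's theorem is used in both directions: [f] matches [H :\: S] outside [nbrs F S], and [g]
    matches [nbrs F S] back into [S]. Gluing [g] with the inverse of [f] stays injective because one
    has values in [S] and the other outside. *)
Lemma deficiency_split (A B : finType) (F : A -> {set B}) (H : {set A})
    (a0 : A) (b0 : B) :
  exists (S : {set A}) (R : {set B}) (c : B -> A),
  [/\ S \subset H, #|R| = #|H :\: S|, [disjoint nbrs F S & R],
      {in nbrs F S :|: R &, injective c}
    & {in nbrs F S :|: R, forall b, c b \in H /\ b \in F (c b)}].
Proof.
(* Natural-number encoding of [#|S| - #|nbrs F S|] being maximal. *)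
have [S SH maxS] : exists2 S : {set A}, S \subset H &
    forall X : {set A}, X \subset H ->
      #|X| + #|nbrs F S| <= #|S| + #|nbrs F X|.
  pose w (X : {set A}) := (#|X| + #|B| - #|nbrs F X|)%N.
  have [S SH maxS] := @arg_maxnP _ (@set0 A) (fun X => X \subset H) w (sub0set H).
  exists S => // X XH; have := maxS X XH; rewrite /w.
  have lX := max_card (nbrs F X); have lS := max_card (nbrs F S).
  lia.
have [f f_inj fF] : exists2 f : A -> B, {in H :\: S &, injective f} &
    {in H :\: S, forall a, f a \in F a :\: nbrs F S}.
  apply: hall => // X XHS; rewrite nbrsD cardsD.
  move: XHS; rewrite subsetD => /andP[XH dXS].
  have := maxS (S :|: X); rewrite subUset SH XH => /(_ isT).
  rewrite nbrsU !cardsU [S :&: X]setIC (disjoint_setI0 dXS) cards0 setIC.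
  have := subset_leq_card (subsetIl (nbrs F X) (nbrs F S)); lia.
have [g g_inj gF] : exists2 g : B -> A, {in nbrs F S &, injective g} &
    {in nbrs F S, forall b, g b \in [set a in S | b \in F a]}.
  apply: hall => // Y YN; set Z := nbrs _ Y.
  have ZS : Z \subset S.
    by apply/subsetP=> a /nbrsP[b _]; rewrite inE => /andP[].
  (* Dropping [Z] from [S] uncovers all of [Y], so maximality forces [#|Y| <= #|Z|]. *)
  have := maxS (S :\: Z) (subset_trans (subsetDl _ _) SH).
  have sN : nbrs F (S :\: Z) \subset nbrs F S :\: Y.
    apply/subsetP=> b /nbrsP[a /setDP[aS aZ] bF].
    rewrite inE; apply/andP; split; last by apply/nbrsP; exists a.
    by apply: contra aZ => bY; apply/nbrsP; exists b => //; rewrite inE aS.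
  move/leq_trans/(_ (leq_add (leqnn _) (subset_leq_card sN))).
  rewrite !cardsD (setIidPr ZS) (setIidPr YN).
  have := subset_leq_card ZS; have := subset_leq_card YN; lia.
(* The second branch inverts [f] on its image [R]; the default [a0] is reached only outside
   [nbrs F S :|: R]. *)
pose c b := if b \in nbrs F S then g b
            else odflt a0 [pick a | (a \in H :\: S) && (f a == b)].
have cR b : b \in f @: (H :\: S) -> c b \in H :\: S /\ f (c b) = b.
  case/imsetP=> a aHS ->; rewrite /c ifN.
    by case: pickP => [a' /andP[? /eqP]|/(_ a)] //; rewrite aHS eqxx.
  by have /setDP[] := fF _ aHS.
have cN b : b \in nbrs F S -> c b \in S /\ b \in F (c b).
  by move=> bN; have := gF b bN; rewrite /c bN inE => /andP.
exists S, (f @: (H :\: S)), c; split=> //.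
- by rewrite card_in_imset.
- rewrite disjoints_subset; apply/subsetP=> b bN; rewrite inE.
  by apply/imsetP=> -[a aHS E]; have := fF _ aHS; rewrite -E inE bN.
- move=> b b' /setUP[bN|bR] /setUP[b'N|b'R] E.
  + by apply: g_inj => //; move: E; rewrite /c bN b'N.
  + have [cS _] := cN _ bN; have [] := cR _ b'R.
    by rewrite -E inE cS.
  + have [cS _] := cN _ b'N; have [] := cR _ bR.
    by rewrite E inE cS.
  + by have [_ <-] := cR _ bR; have [_ <-] := cR _ b'R; rewrite E.
- move=> b /setUP[bN|bR].
    by have [cS ?] := cN _ bN; rewrite (subsetP SH).
  have [cHS E] := cR _ bR; have /setDP[+ _] := fF _ cHS.
  by rewrite E; have /setDP[] := cHS.
Qed.

(** * Greedy embedding of a tree *)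

Definition nbrs_in (V : finType) (E : {set {set V}}) (W : {set V}) (x : V) :
    {set V} :=
  [set y in W | (y != x) && ([set x; y] \in E)].

Section TreeEmbedding.
Variables (T : sgraph) (V : finType) (E : {set {set V}}).
Hypothesis treeT : is_tree T.

Definition induced (S : {set T}) : rel T :=
  [rel x y | [&& sedge x y, x \in S & y \in S]].

(** Otherwise [v] would close a simple path from [u] to [u'] inside [S] into a cycle. *)
Lemma tree_unique_nbr (S : {set T}) (v u u' : T) :
    {in S &, forall x y, connect (induced S) x y} -> v \notin S ->
  u \in S -> u' \in S -> sedge v u -> sedge v u' -> u = u'.
Proof.
move=> connS vS uS u'S vu vu'; apply/eqP; apply: contraT => neq.
have /connectP[p0 p0_path last_p0] := connS u u' uS u'S.
case/shortenP: p0_path last_p0 => p p_path p_uniq _ last_p0.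
(* An empty path means [u = u']; a nonempty one gives the cycle the three vertices that
   [acyclic_graph] asks for. *)
case: p => [|y p] in p_path p_uniq last_p0; first by rewrite last_p0 eqxx in neq.
have [_ /(_ [:: v, u, y & p] isT)[]] := treeT.
have pS : {subset u :: y :: p <= S}.
  move=> z; rewrite inE => /predU1P[->//|].
  elim: (y :: p) u p_path {uS vu p_uniq last_p0 neq} => //= z' q IH w.
  case/andP=> /and3P[_ _ z'S] /IH{}IH; rewrite inE => /predU1P[->//|]; exact: IH.
rewrite /ucycle (cons_uniq v) p_uniq andbT; apply/andP; split; last first.
  by apply: contra vS; apply: pS.
rewrite /cycle rcons_path last_cons -last_p0 sedge_sym vu' andbT /= vu.
by apply: sub_path p_path => a b /and3P[].
Qed.

Lemma tree_boundary (S : {set T}) (x0 : T) :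
  x0 \in S -> S != setT -> exists u v, [/\ u \in S, v \notin S & sedge u v].
Proof.
move=> x0S; rewrite -subTset => /subsetPn[y _ yS].
have [[_ conn] _] := treeT; have /connectP[p] := conn x0 y.
elim: p x0 x0S => /= [x xS _ yx|z p IH x xS /andP[xz zp]]; first by rewrite yx xS in yS.
have [zS|zS] := boolP (z \in S); first exact: IH.
by exists x, z.
Qed.

(** The embedding grows one vertex at a time. The embedded part [S] is kept connected, so that a new
    vertex [v] has a single edge into [S] to respect. *)
Lemma tree_embedding (W : {set V}) :
    W != set0 -> {in W, forall x, #|T| <= #|nbrs_in E W x|.+1} ->
  exists2 phi : T -> V, injective phi &
    forall u v, sedge u v -> [set phi u; phi v] \in E.
Proof.
move=> /set0Pn[w0 w0W] degW; have [[T0 _] _] := treeT.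
suff partial i : i < #|T| -> exists (S : {set T}) (phi : T -> V),
    [/\ #|S| = i.+1, {in S &, forall x y, connect (induced S) x y},
        {in S &, injective phi}, {in S, forall x, phi x \in W}
      & {in S &, forall u v, sedge u v -> [set phi u; phi v] \in E}].
  have [|S [phi [cS _ inj _ hom]]] := partial #|T|.-1; first by rewrite prednK.
  have ST : S = setT by apply/eqP; rewrite eqEcard subsetT cardsT cS prednK /=.
  exists phi => [x y|u v]; first by apply: inj; rewrite ST.
  by apply: hom; rewrite ST.
elim: i => [_|i IH lt_iT].
  have /card_gt0P[t _] := T0; exists [set t], (fun=> w0).
  split; rewrite ?cards1 //.
  - by move=> x y /set1P-> /set1P->.
  - by move=> x y /set1P-> /set1P->.
  - by move=> u v /set1P-> /set1P->; rewrite sedge_irrefl.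
have [S [phi [cS connS inj phiW hom]]] := IH (ltnW lt_iT).
have /card_gt0P[x0 x0S] : 0 < #|S| by rewrite cS.
have [|u [v [uS vS uv]]] := tree_boundary x0S.
  by apply: contraTneq lt_iT => ST; rewrite -leqNgt -cardsT -ST cS.
(* If all neighbours of [phi u] in [W] were used, they would lie in [phi @: S] minus [phi u], so
   there would be at most [i] of them, against the degree bound. *)
have [w /andP[wN wS]] : exists w, (w \in nbrs_in E W (phi u)) && (w \notin phi @: S).
  apply/existsP; apply: contraTT lt_iT; rewrite negb_exists => /forallP all_used.
  rewrite -leqNgt; apply: leq_trans (degW _ (phiW _ uS)) _.
  suff /subset_leq_card : nbrs_in E W (phi u) \subset phi @: S :\ phi u.
    move=> le; apply: leq_ltn_trans le _.
    by rewrite -cS -(card_in_imset inj) (cardsD1 (phi u) (phi @: S)) imset_f.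
  apply/subsetP=> y yN; have := all_used y; rewrite yN /= negbK => yS.
  by move: yN; rewrite !inE yS andbT => /and3P[].
move: wN; rewrite inE => /and3P[wW _ uwE].
have neq x : x \in S -> (x == v) = false.
  by move=> xS; apply: contraNF vS => /eqP<-.
pose phi' x := if x == v then w else phi x.
have phi'S x : x \in S -> phi' x = phi x by move=> xS; rewrite /phi' neq.
have phi'v : phi' v = w by rewrite /phi' eqxx.
have sub_conn x y : x \in S -> y \in S -> connect (induced (v |: S)) x y.
  move=> xS yS; have := connS x y xS yS; apply: connect_sub => a b.
  case/and3P=> ab aS bS; apply: connect1.
  by rewrite /induced /= ab !inE aS bS !orbT.
have uvI : induced (v |: S) u v by rewrite /induced /= uv !inE uS eqxx orbT.
have vuI : induced (v |: S) v u.
  by rewrite /induced /= sedge_sym uv !inE uS eqxx orbT.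
exists (v |: S), phi'; split.
- by rewrite cardsU1 vS cS.
- move=> x y /setU1P[->|xS] /setU1P[->|yS] //.
  + exact: connect_trans (connect1 vuI) (sub_conn _ _ uS yS).
  + exact: connect_trans (sub_conn _ _ xS uS) (connect1 uvI).
  + exact: sub_conn.
- move=> x y /setU1P[->|xS] /setU1P[->|yS] //; rewrite ?phi'v ?phi'S //.
  + by move=> eq; case/negP: wS; rewrite eq imset_f.
  + by move=> eq; case/negP: wS; rewrite -eq imset_f.
  + exact: inj.
- by move=> x /setU1P[->|xS]; rewrite ?phi'v ?phi'S //; apply: phiW.
- have vxE x : x \in S -> sedge v x -> x = u.
    by move=> xS vx; apply: (tree_unique_nbr connS vS) => //; rewrite sedge_sym.
  move=> x y /setU1P[->|xS] /setU1P[->|yS]; rewrite ?phi'v ?phi'S //.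
  + by rewrite sedge_irrefl.
  + by move/(vxE _ yS)->; rewrite setUC.
  + by rewrite sedge_sym => /(vxE _ xS)->.
  + exact: hom.
Qed.

End TreeEmbedding.

(** * Counting cliques and edges by vertex deletion *)

Lemma cards_within_split (V : finType) (X : {set {set V}}) (W : {set V}) x :
  #|[set h in X | h \subset W]| =
  #|[set h in X | h \subset W :\ x]| + #|[set h in X | (h \subset W) && (x \in h)]|.
Proof.
rewrite -(cardsID [set h : {set V} | x \in h]) addnC; congr (_ + _); apply: eq_card => h.
  by rewrite !inE subsetD1; case: (x \in h); rewrite ?andbT ?andbF.
by rewrite !inE andbA.
Qed.

Section LocalCounts.
Variables (V : finType) (W : {set V}) (x : V).

(** Removing [x] maps these cliques injectively to [r.-1]-subsets of the neighbourhood of [x]. *)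
Lemma card_star_cliques (A E : {set {set V}}) (r : nat) :
    {in A, forall h : {set V}, #|h| = r} ->
    {in A, forall h : {set V}, {in h &, forall y z, y != z -> [set y; z] \in E}} ->
  #|[set h in A | (h \subset W) && (x \in h)]| <= 'C(#|nbrs_in E W x|, r.-1).
Proof.
move=> cardA cliqueA; rewrite -cards_draws.
set star := [set h in A | _].
rewrite -(card_in_imset (f := fun h : {set V} => h :\ x) (D := star)); last first.
  move=> h h'; rewrite !inE => /and3P[_ _ xh] /and3P[_ _ xh'] eqD.
  by rewrite -(setD1K xh) eqD setD1K.
apply/subset_leq_card/subsetP=> _ /imsetP[h + ->].
rewrite !inE => /and3P[hA hW xh].
have := cardsD1 x h; rewrite xh cardA // => ->; rewrite eqxx andbT.
apply/subsetP=> y; rewrite !inE => /andP[yx yh].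
by rewrite (subsetP hW) // yx (cliqueA h) // eq_sym.
Qed.

Lemma card_star_pairs (E : {set {set V}}) :
    {in E, forall p : {set V}, #|p| = 2} ->
  #|[set p in E | (p \subset W) && (x \in p)]| <= #|nbrs_in E W x|.
Proof.
move=> card2; apply: leq_trans (leq_imset_card (fun y => [set x; y]) _).
apply/subset_leq_card/subsetP=> p; rewrite inE => /and3P[pE pW xp].
have /cards1P[y py] : #|p :\ x| == 1 by have := cardsD1 x p; rewrite xp card2 //; lia.
have : y \in p :\ x by rewrite py set11.
rewrite !inE => /andP[yx yp].
have pxy : p = [set x; y] by rewrite -(setD1K xp) py.
by apply/imsetP; exists y => //; rewrite inE (subsetP pW) // yx -pxy.
Qed.

End LocalCounts.

(** [B] is the blue graph, [A] a family of its [r]-cliques and [R] the red graph. Induction on [W]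
    deletes a vertex of degree less than [k], at a cost of at most [M]. *)
Lemma card_cliques_pairs (T : sgraph) (V : finType) (A B R : {set {set V}})
    (k r M : nat) :
    is_tree T -> #|T| = k.+1 -> 2 <= r ->
    {in A, forall h : {set V}, #|h| = r} ->
    {in A, forall h : {set V}, {in h &, forall y z, y != z -> [set y; z] \in B}} ->
    {in R, forall p : {set V}, #|p| = 2} -> [disjoint B & R] ->
    ~ (exists2 phi : T -> V, injective phi &
         forall u v, sedge u v -> [set phi u; phi v] \in B :|: R) ->
    (forall a b, a + b < k -> a + 'C(b, r.-1) <= M) ->
  #|A| + #|R| <= M * #|V|.
Proof.
move=> treeT cardT r2 cardA cliqueA cardR dBR noT boundM.
suff within (W : {set V}) : #|[set h in A | h \subset W]| +
    #|[set p in R | p \subset W]| <= M * #|W|.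
  have all (X : {set {set V}}) : [set h in X | h \subset [set: V]] = X.
    by apply/setP=> h; rewrite inE subsetT andbT.
  by have := within setT; rewrite !all cardsT.
have [m] := ubnP #|W|; elim: m W => // m IH W leWm.
have [->|W0] := eqVneq W set0.
  rewrite cards0 muln0 leqn0 addn_eq0 !cards_eq0.
  apply/andP; split; apply/eqP/setP=> h; rewrite !inE subset0.
    by apply: contraTF r2 => /andP[/cardA <- /eqP->]; rewrite cards0.
  by apply/negP=> /andP[/cardR + /eqP h0]; rewrite h0 cards0.
have /existsP[x /andP[xW degx]] : [exists x, (x \in W) &&
    (#|nbrs_in (B :|: R) W x| < k)].
  apply: contraT; rewrite negb_exists => /forallP degW.
  case: noT; apply: (tree_embedding treeT W0) => x xW.
  by have := degW x; rewrite xW -leqNgt cardT.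
have := IH (W :\ x); rewrite (cardsD1 x W) xW in leWm *.
move=> /(_ leWm); rewrite !(cards_within_split _ W x) add1n mulnS.
have := card_star_cliques W x cardA cliqueA; have := card_star_pairs W x cardR.
(* Since [B] and [R] are disjoint, the red and blue degrees add up to the degree in the union. *)
have /boundM : #|nbrs_in R W x| + #|nbrs_in B W x| < k.
  apply: leq_ltn_trans degx; rewrite -cardsUI.
  rewrite (_ : _ :&: _ = set0) ?cards0 ?addn0.
    apply/subset_leq_card/subsetP=> y; rewrite !inE.
    by case/orP=> /and3P[-> -> ->]; rewrite ?orbT.
  apply/setP=> y; rewrite !inE; apply/negP=> /andP[/and3P[_ _ yR] /and3P[_ _ yB]].
  by have := disjointFr dBR yB; rewrite yR.
lia.
Qed.

(** * From representatives to Berge copies *)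

Lemma berge_of_sdr (T : sgraph) (V : finType) (H E : {set {set V}})
    (c : {set V} -> {set V}) (phi : T -> V) :
    {in E &, injective c} ->
    {in E, forall p, c p \in H /\ p \subset c p} -> injective phi ->
    (forall u v, sedge u v -> [set phi u; phi v] \in E) ->
  contains_berge T H.
Proof.
move=> c_inj cH phi_inj hom.
have edgeE u v : phi @: [set u; v] = [set phi u; phi v].
  by rewrite imsetU1 imset_set1.
have homE e : e \in edges T -> phi @: e \in E.
  by case/imsetP=> -[u v]; rewrite inE /= => uv ->; rewrite edgeE hom.
apply/existsP; exists (finfun phi); apply/existsP.
(* Edges are sets, so [phi @: e] names the image edge without ordering its ends. *)
exists [ffun e : {set T} => c (phi @: e)]; apply/and4P; split.
- by apply/injectiveP=> u v; rewrite !ffunE; apply: phi_inj.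
- apply/dinjectiveP=> e e' eT e'T; rewrite !ffunE => eqc.
  by apply: (imset_inj phi_inj); apply: c_inj => //; apply: homE.
- by apply/forall_inP=> e eT; rewrite ffunE; have [] := cH _ (homE _ eT).
- apply/forallP=> u; apply/forallP=> v; apply/implyP=> uv.
  by rewrite !ffunE edgeE; have [] := cH _ (hom _ _ uv).
Qed.

Lemma berge_free_card (T : sgraph) (V : finType) (H : {set {set V}})
    (k r M : nat) :
    is_tree T -> #|T| = k.+1 -> 2 <= r -> uniform r H -> berge_free T H ->
    (forall a b, a + b < k -> a + 'C(b, r.-1) <= M) ->
  #|H| <= M * #|V|.
Proof.
move=> treeT cardT r2 /forall_inP cardH freeH boundM.
pose pairs (h : {set V}) := [set p : {set V} | (p \subset h) && (#|p| == 2)].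
have [S [R [c [SH cardR dSR c_inj cH]]]] := deficiency_split pairs H set0 set0.
have -> : #|H| = #|S| + #|R|.
  by rewrite cardR -(cardsID S H) (setIidPr SH).
apply: (card_cliques_pairs treeT cardT r2 (B := nbrs pairs S)) => //.
- by move=> h /(subsetP SH)/cardH/eqP.
- move=> h hS y z yh zh yz; apply/nbrsP; exists h => //.
  by rewrite inE cards2 yz subUset !sub1set yh zh.
- move=> p pR; have [|_] := cH p; first by rewrite inE pR orbT.
  by rewrite inE => /andP[_ /eqP].
- case=> phi phi_inj hom; case/negP: freeH.
  apply: (berge_of_sdr c_inj _ phi_inj hom) => p /cH[cpH].
  by rewrite inE => /andP[].
Qed.

(** * Binomial estimates and the final bounds *)

Lemma leq_add_bin_small (a b m s : nat) :
  0 < s -> m <= s -> a + b <= m -> a + 'C(b, s) <= m.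
Proof.
move=> s0 ms ab; have [bs|bs] := ltnP b s; first by rewrite bin_small //; lia.
by rewrite (_ : b = s) ?binn; lia.
Qed.

(** Lowering both [a] and [m] by one costs one on the left and, by Pascal's rule, at least one on
    the right. *)
Lemma leq_add_bin (a b m s : nat) :
  0 < s < m -> a + b <= m -> a + 'C(b, s) <= 'C(m, s).
Proof.
case/andP=> s0; elim: m a => // m IH [|a] lt_sm le_abm; first exact: leq_bin2l.
case: s s0 lt_sm IH => // s _ lt_sm IH; rewrite binS.
have bin1 : 0 < 'C(m, s) by rewrite bin_gt0; lia.
have [lt_s|le_s] := ltnP s.+1 m; first by have := IH a lt_s; lia.
(* Here the induction hypothesis is out of reach, but the right side is exactly [s.+2]. *)
have -> : m = s.+1 by lia.
by rewrite binn binSn; have := @leq_add_bin_small a b m s.+1; lia.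
Qed.

Lemma ex_berge_le (T : sgraph) (k r n M : nat) :
    is_tree T -> #|T| = k.+1 -> 2 <= r ->
    (forall a b, a + b < k -> a + 'C(b, r.-1) <= M) ->
  ex_berge r n T <= M * n.
Proof.
move=> treeT cardT r2 boundM; apply/bigmax_leqP=> H /andP[unifH freeH].
by have := berge_free_card treeT cardT r2 unifH freeH boundM; rewrite card_ord.
Qed.

Local Open Scope ring_scope.

Theorem proposition11 (k r n : nat) (T : sgraph)
    (hk : (1 <= k)%N) (hr : (2 <= r)%N) (hn : (0 < n)%N)
    (hT : is_tree T) (hTk : #|T| = k.+1) :
  ((r < k)%N ->
     (ex_berge r n T)%:R
       <= 2%:R * (r%:R - 1) / k%:R * 'C(k, r)%:R * n%:R :> rat) /\
  ((k <= r)%N ->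
     (ex_berge r n T)%:R <= (k%:R - 1) * n%:R :> rat).
Proof.
split=> hrk.
- have le_ex : (ex_berge r n T <= 'C(k.-1, r.-1) * n)%N.
    by apply: (ex_berge_le n hT hTk hr) => a b ab; apply: leq_add_bin; lia.
  (* The count gives the factor [r / k * 'C(k, r)]; the stated bound follows from
     [r <= 2 * (r - 1)], as [2 <= r]. *)
  have binE : k%:R * 'C(k.-1, r.-1)%:R = r%:R * 'C(k, r)%:R :> rat.
    rewrite -!natrM; congr _%:R; case: k r hk hr {hTk hrk le_ex} => // k [//|r] _ _.
    exact: mul_bin_diag.
  have k0 : k%:R != 0 :> rat by rewrite pnatr_eq0; lia.
  have r2 : 2%:R <= r%:R :> rat by rewrite ler_nat.
  apply: (le_trans (y := ('C(k.-1, r.-1) * n)%:R)); first by rewrite ler_nat.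
  rewrite natrM ler_wpM2r // -(mulKf k0 'C(k.-1, r.-1)%:R) binE.
  rewrite mulrAC [leRHS]mulrC ler_wpM2l ?invr_ge0 // ler_wpM2r //; lra.
- have -> : k%:R - 1 = k.-1%:R :> rat by rewrite -subn1 natrB.
  rewrite -natrM ler_nat.
  by apply: (ex_berge_le n hT hTk hr) => a b ab; apply: leq_add_bin_small; lia.
Qed.
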